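(* Let $\mathcal P$ be the set of STL formulae, let $\mathcal T$ be a trajectory space which is bounded in the supremum norm, let $I\subset\mathbb R_{\ge 0}$ be a bounded interval, and let $\mu_0$ be a probability measure on $\mathcal T$. Define $k':\mathcal P\times\mathcal P\to\mathbb R$ by $$k'(\varphi,\psi)=\int_{\xi\in\mathcal T}\int_{t\in I}\rho(\varphi,\xi,t)\,\rho(\psi,\xi,t)\,dt\,d\mu_0(\xi).$$ Then $k'$ is a proper kernel function: there exist a Hilbert space $\mathbb H$ and a map $\Phi:\mathcal P\to\mathbb H$ such that $k'(\varphi,\psi)=\langle\Phi(\varphi),\Phi(\psi)\rangle_{\mathbb H}$ for all $\varphi,\psi\in\mathcal P$.
   Context: Trajectories are continuous functions $\xi:\mathbb R_{\ge0}\to\mathbb R^n$ (for a fixed $n$). The trajectory space $\mathcal T$ is a set of such functions, and it is bounded in the supremum norm: there is $B\in\mathbb R$ with $\sup_t\|\xi(t)\|\le B$ for all $\xi\in\mathcal T$. The probability measure $\mu_0$ is defined on a $\sigma$-algebra on $\mathcal T$ for which $(\xi,t)\mapsto\rho(\varphi,\xi,t)$ is measurable for every formula $\varphi$. STL formulae are generated by $\varphi ::= tt \mid \pi \mid \neg\varphi \mid \varphi_1\wedge\varphi_2 \mid \varphi_1\,\mathbf U_{[a,b]}\,\varphi_2$ with $a<b$ rationals, where an atomic predicate $\pi$ has the form $f_\pi(x_1,\dots,x_n)\ge 0$ for a continuous function $f_\pi:\mathbb R^n\to\mathbb R$. The robustness $\rho(\varphi,\xi,t)$ is defined recursively: $\rho(\pi,\xi,t)=f_\pi(\xi(t))$;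 $\rho(\neg\varphi,\xi,t)=-\rho(\varphi,\xi,t)$; $\rho(\varphi_1\wedge\varphi_2,\xi,t)=\min(\rho(\varphi_1,\xi,t),\rho(\varphi_2,\xi,t))$; $\rho(\varphi_1\mathbf U_{[a,b]}\varphi_2,\xi,t)=\max_{t'\in[a+t,b+t]}\min\big(\rho(\varphi_2,\xi,t'),\min_{t''\in[t,t']}\rho(\varphi_1,\xi,t'')\big)$ (the robustness of $tt$ is a fixed positive constant).
   Formalization: The until operator U_[a,b] is restricted to rationals 0 ≤ a < b; for a < 0 the robustness is undefined, since it evaluates trajectories at negative times and takes a minimum over an empty interval [t,t']. *)

(* Defs.v *)
From HB Require Import structures.
From mathcomp Require Import all_boot all_order all_algebra.
From mathcomp Require Import all_classical all_reals all_analysis.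
Set Implicit Arguments. Unset Strict Implicit. Unset Printing Implicit Defensive.
Import Order.TTheory GRing.Theory Num.Theory.
Import numFieldNormedType.Exports.
Local Open Scope classical_set_scope.
Local Open Scope ring_scope.

Inductive stl (R : realType) (n : nat) : Type :=
  | STt
  | SAtom (f : 'rV[R]_n -> R) of continuous f
  | SNeg of stl R n
  | SAnd of stl R n & stl R n
  | SUntil (a b : rat) of (0 <= a) & (a < b) & stl R n & stl R n.

(* Quantitative semantics (robustness).  [ctt] is the fixed positive
   robustness of [tt]. The max / min over compact time intervals are
   written as sup / inf (they coincide since the functions are continuous). *)
Fixpoint rho (R : realType) (n : nat) (ctt : R) (phi : stl R n)
    (xi : R -> 'rV[R]_n) (t : R) : R :=
  match phi with
  | STt => ctt
  | SAtom f _ => f (xi t)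
  | SNeg p => - rho ctt p xi t
  | SAnd p q => Num.min (rho ctt p xi t) (rho ctt q xi t)
  | SUntil a b _ _ p q =>
      sup [set Num.min (rho ctt q xi t')
                       (inf [set rho ctt p xi t'' | t'' in `[t, t']])
          | t' in `[ratr a + t, ratr b + t]]
  end.

(* Real Hilbert space: a complete normed space whose norm comes from an
   inner product. *)
Definition is_inner_product (R : realType) (H : completeNormedModType R)
    (ip : H -> H -> R) : Prop :=
  [/\ (forall x y, ip x y = ip y x),
      (forall a x y z, ip (a *: x + y) z = a * ip x z + ip y z)
    & (forall x, ip x x = `|x| ^+ 2)].

Definition kprime (R : realType) (n : nat) (ctt : R) (d : measure_display)
    (X : measurableType d) (traj : X -> R -> 'rV[R]_n)
    (mu0 : probability X R) (I : set R) (phi psi : stl R n) : R :=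
  Rintegral mu0 setT (fun x =>
    Rintegral (@lebesgue_measure R) I
      (fun t => rho ctt phi (traj x) t * rho ctt psi (traj x) t)).

(* Main.v *)
(* The robustness of every formula is bounded over the trajectories, so after
   restriction to T x I it is an element of L^2(mu0 x dt), and by Fubini k' is
   the L^2 inner product of these restrictions. Instead of the completeness of
   L^2, one uses that the closure, in the dual norm, of the functionals
   b(v, -) of a positive semidefinite form b is a Hilbert space: a Cauchy
   filter of functionals has a pointwise limit, which inherits the
   approximability by some b(v, -), and the polarization formula defines an
   inner product because it is continuous and bilinear on a dense subspace. *)
Require Import Defs.
From HB Require Import structures.
From mathcomp Require Import all_boot all_order all_algebra.
From mathcomp Require Import all_classical all_reals all_analysis.
From mathcomp Require Import measurable_realfun ring lra.
Import Order.TTheory GRing.Theory Num.Theory.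
Import numFieldNormedType.Exports.
Set Implicit Arguments.
Unset Strict Implicit.
Unset Printing Implicit Defensive.
Local Open Scope classical_set_scope.
Local Open Scope ring_scope.

(** * Positive semidefinite forms and their seminorm *)

Record psd_form (R : realType) (V : lmodType R) := PsdForm {
  psd_fun :> V -> V -> R;
  psdC : forall u v, psd_fun u v = psd_fun v u;
  psdDZl : forall a u v w,
    psd_fun (a *: u + v) w = a * psd_fun u w + psd_fun v w;
  psd_ge0 : forall v, 0 <= psd_fun v v }.

Section psd_form_theory.
Context {R : realType} {V : lmodType R} (b : psd_form V).
Implicit Types (u v w : V) (a : R).

Lemma psdDl u v w : b (u + v) w = b u w + b v w.
Proof. by rewrite -[u]scale1r psdDZl mul1r scale1r. Qed.

Lemma psd0l w : b 0 w = 0.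
Proof. by apply: (addrI (b 0 w)); rewrite -psdDl !addr0. Qed.

Lemma psdZl a u w : b (a *: u) w = a * b u w.
Proof. by rewrite -[a *: u]addr0 psdDZl psd0l addr0. Qed.

Lemma psdDr w u v : b w (u + v) = b w u + b w v.
Proof. by rewrite (psdC b) psdDl !(psdC b _ w). Qed.

Lemma psdZr a w u : b w (a *: u) = a * b w u.
Proof. by rewrite (psdC b) psdZl (psdC b _ w). Qed.

Definition psd_norm v := Num.sqrt (b v v).

Lemma psd_norm_ge0 v : 0 <= psd_norm v.
Proof. exact: sqrtr_ge0. Qed.

Lemma sqr_psd_norm v : psd_norm v ^+ 2 = b v v.
Proof. by rewrite sqr_sqrtr// psd_ge0. Qed.

(** The quadratic [b (u + a *: v) (u + a *: v)] in [a] is nonnegative. The form may be degenerate,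
    so [b v v = 0] is a separate case. *)
Lemma psd_cauchy_schwarz u v : `|b u v| <= psd_norm u * psd_norm v.
Proof.
rewrite -(@ler_pXn2r _ 2)// ?nnegrE ?mulr_ge0 ?psd_norm_ge0//.
rewrite exprMn !sqr_psd_norm real_normK ?num_real//.
have quad a : 0 <= b u u + a * (b u v *+ 2) + a ^+ 2 * b v v.
  have := psd_ge0 b (u + a *: v).
  by rewrite psdDl !psdDr !psdZl !psdZr (psdC b v u); congr (_ <= _); ring.
have [v0|v0] := eqVneq (b v v) 0.
  have [->|uv0] := eqVneq (b u v) 0.
    by rewrite expr0n/= mulr_ge0 ?psd_ge0.
  (* Here the quadratic is affine in [a] with nonzero slope; this [a] gives it the value -1. *)
  have := quad (- (b u u + 1) / (b u v *+ 2)).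
  by rewrite v0 divfK ?mulrn_eq0//= mulr0 addr0; lra.
have v_gt0 : 0 < b v v by rewrite lt_def v0 psd_ge0.
(* This is the minimizer of the quadratic. *)
have := quad (- b u v / b v v).
have -> : b u u + - b u v / b v v * (b u v *+ 2) +
    (- b u v / b v v) ^+ 2 * b v v = (b u u * b v v - b u v ^+ 2) / b v v by field.
by rewrite pmulr_lge0 ?invr_gt0// subr_ge0.
Qed.

End psd_form_theory.

(** * The Hilbert space of approximable functionals *)

Section hilbert_completion.
Context {R : realType} {V : lmodType R} (b : psd_form V).
Local Notation N := (psd_norm b).
Implicit Types (v w : V).

(* [f] is a limit of functionals [b v] for the dual norm. Taking functionals
   rather than classes of Cauchy sequences avoids quotienting by the kernel of
   [b]; linearity of [f] is a consequence. *)
Definition approximable : {pred V -> R} := mem [set f : V -> R |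
  forall e, 0 < e -> exists v, forall w, `|f w - b v w| <= e * N w].

Lemma approximableP (f : V -> R) : reflect
  (forall e, 0 < e -> exists v, forall w, `|f w - b v w| <= e * N w)
  (f \in approximable).
Proof. by apply: (iffP idP); rewrite inE. Qed.

Lemma approximable_submod : submod_closed approximable.
Proof.
split=> [|a f g /approximableP fa /approximableP ga];
  apply/approximableP => e e0.
  exists 0 => w; rewrite psd0l subrr normr0.
  by rewrite mulr_ge0 ?psd_norm_ge0// ltW.
(* Adding 1 keeps the divisor positive when [a = 0]. *)
have a0 : 0 < 2 * (`|a| + 1) by rewrite mulr_gt0// ltr_wpDl.
have [v vf] := fa (e / (2 * (`|a| + 1))) (divr_gt0 e0 a0).
have [v' vg] := ga (e / 2) (divr_gt0 e0 (ltr0n _ 2)).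
exists (a *: v + v') => w; rewrite psdDZl.
have -> : (a *: f + g) w - (a * b v w + b v' w) =
    a * (f w - b v w) + (g w - b v' w).
  have -> : (a *: f + g) w = a * f w + g w by [].
  ring.
rewrite (le_trans (ler_normD _ _))// normrM.
have -> : e * N w = e / 2 * N w + e / 2 * N w by field.
apply: lerD => //; apply: le_trans (ler_wpM2l (normr_ge0 a) (vf w)) _.
rewrite mulrA ler_wpM2r ?psd_norm_ge0// mulrCA ler_wpM2l ?(ltW e0)//.
by rewrite ler_pdivrMr//; have := normr_ge0 a; lra.
Qed.

HB.instance Definition _ :=
  GRing.isSubmodClosed.Build R (V -> R) approximable approximable_submod.

Record completion := Completion {
  functional :> V -> R ;
  functional_approximable : functional \in approximable }.

HB.instance Definition _ := [isSub for functional].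
HB.instance Definition _ := gen_eqMixin completion.
HB.instance Definition _ := gen_choiceMixin completion.
HB.instance Definition _ := [SubChoice_isSubLmodule of completion by <:].

Implicit Types f g : completion.

Lemma completion_ext f g : f =1 g -> f = g.
Proof. by move=> fg; apply: val_inj; exact/funext. Qed.

Lemma completionDE f g w : (f + g) w = f w + g w.
Proof. by []. Qed.

Lemma completionZE a f w : (a *: f) w = a * f w.
Proof. by []. Qed.

(** The dual norm is the infimum of the admissible constants rather than a supremum of quotients,
    because [N w] may vanish for nonzero [w]. *)
Definition dual_bounds f :=
  [set C : R | 0 <= C /\ forall w, `|f w| <= C * N w].

(** Some [b v] lies within distance 1 of [f], and Cauchy-Schwarz bounds [b v] by [N v]. *)
Lemma dual_bounds_nonempty f : dual_bounds f !=set0.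
Proof.
have /approximableP/(_ 1 ltr01)[v fv] := functional_approximable f.
exists (1 + N v); split=> [|w]; first by rewrite addr_ge0// psd_norm_ge0.
rewrite mulrDl -[f w](subrK (b v w)).
by rewrite (le_trans (ler_normD _ _))// lerD// psd_cauchy_schwarz.
Qed.

Definition dual_norm f := inf (dual_bounds f).

Lemma dual_norm_ge0 f : 0 <= dual_norm f.
Proof. by apply: lb_le_inf => [|C []//]; exact: dual_bounds_nonempty. Qed.

Lemma dual_normP f w : `|f w| <= dual_norm f * N w.
Proof.
have [C0 [C00 fC0]] := dual_bounds_nonempty f.
have := psd_norm_ge0 b w; rewrite le_eqVlt => /predU1P[w0|w0].
  (* If [N w = 0], any admissible constant already forces [f w = 0]. *)
  by rewrite -w0 mulr0 -(mulr0 C0) w0.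
rewrite -ler_pdivrMr//; apply: lb_le_inf => [|C [_ fC]].
  exact: dual_bounds_nonempty.
by rewrite ler_pdivrMr.
Qed.

Lemma dual_norm_le f C :
  0 <= C -> (forall w, `|f w| <= C * N w) -> dual_norm f <= C.
Proof. by move=> C0 fC; apply: ge_inf => //; exists 0 => ? []. Qed.

Lemma dual_norm_triangle f g : dual_norm (f + g) <= dual_norm f + dual_norm g.
Proof.
apply: dual_norm_le => [|w]; first by rewrite addr_ge0// dual_norm_ge0.
rewrite completionDE mulrDl (le_trans (ler_normD _ _))//.
by rewrite lerD// dual_normP.
Qed.

Lemma dual_norm0_eq0 f : dual_norm f = 0 -> f = 0.
Proof.
move=> f0; apply: completion_ext => w; apply/eqP.
by rewrite -normr_le0 -(mul0r (N w)) -f0 dual_normP.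
Qed.

Lemma dual_normZ a f : dual_norm (a *: f) = `|a| * dual_norm f.
Proof.
have leZ c g : dual_norm (c *: g) <= `|c| * dual_norm g.
  apply: dual_norm_le => [|w]; first by rewrite mulr_ge0// dual_norm_ge0.
  by rewrite completionZE normrM -mulrA ler_wpM2l// dual_normP.
apply/eqP; rewrite eq_le leZ/=; have [->|a0] := eqVneq a 0.
  by rewrite normr0 mul0r dual_norm_ge0.
(* The reverse inequality is [leZ] for the scalar [a^-1] and the functional [a *: f]. *)
rewrite -ler_pdivlMl ?normr_gt0// -normfV.
by rewrite (le_trans _ (leZ _ _))// scalerA mulVf// scale1r.
Qed.

HB.instance Definition _ := Lmodule_isNormed.Build R completion
  dual_norm_triangle dual_normZ dual_norm0_eq0.

Lemma completion_complete (F : set_system completion) :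
  ProperFilter F -> cauchy F -> cvg F.
Proof.
move=> FF /cauchyP Fc.
have Fc' e : 0 < e -> exists h : completion, F [set g : completion |
    forall w, `|h w - g w| <= e * N w].
  move=> e0; have [h Fh] := Fc e e0; exists h.
  apply: filterS Fh => g; rewrite -ball_normE/= => hg w.
  apply: le_trans (dual_normP (h - g) w) _.
  by rewrite ler_wpM2r ?psd_norm_ge0// ltW.
pose ev w (f : completion) := f w.
have evc w : cvg (ev w @ F).
  apply/cauchy_cvgP/cauchyP => e e0.
  have Nw0 : 0 < N w + 1 by rewrite ltr_wpDl ?psd_norm_ge0.
  have [h Fh] := Fc' (e / (N w + 1)) (divr_gt0 e0 Nw0).
  exists (h w).
  change (F [set g : completion | ball (h w) e (g w)]).
  apply: filterS Fh => g /(_ w) hg.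
  rewrite -ball_normE; apply: le_lt_trans hg _; rewrite mulrAC ltr_pdivrMr//.
  by rewrite ltr_pM2l// ltrDl.
pose L w := lim (ev w @ F).
(* Letting [g] tend along [F] in the bound around [h] keeps it uniform in [w]. Such [h] give both
   the approximability of [L] and convergence in the dual norm, which pointwise convergence alone
   would not. *)
have LF e : 0 < e -> exists h : completion,
    (forall w, `|L w - h w| <= e * N w) /\
    F [set g : completion | forall w, `|h w - g w| <= e * N w].
  move=> e0; have [h Fh] := Fc' e e0; exists h; split=> // w.
  have : `|ev w g - h w| @[g --> F] --> `|L w - h w|.
    by apply: cvg_norm; apply: cvgB; [exact: evc|exact: cvg_cst].
  move=> /cvg_lim <-//; apply: limr_le.
    by apply: is_cvg_norm; apply: is_cvgB; [exact: evc|exact: is_cvg_cst].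
  by apply: filterS Fh => g /(_ w); rewrite distrC.
have La : L \in approximable.
  apply/approximableP => e e0; have e20 : 0 < e / 2 by rewrite divr_gt0.
  have [h [Lh _]] := LF _ e20.
  have /approximableP/(_ _ e20)[v hv] := functional_approximable h.
  exists v => w; rewrite [e]splitr mulrDl -(subrKA (h w)).
  by rewrite (le_trans (ler_normD _ _))// lerD.
apply/cvg_ex; exists (Completion La); apply/cvgrPdist_le => e e0.
have [h [Lh Fh]] := LF (e / 2) (divr_gt0 e0 (ltr0n _ 2)).
apply: filterS Fh => g hg; apply: dual_norm_le => [|w]; first exact: ltW.
have -> : (Completion La - g) w = (L w - h w) + (h w - g w).
  by rewrite subrKA.
by rewrite [e]splitr mulrDl (le_trans (ler_normD _ _))// lerD.
Qed.

HB.instance Definition _ :=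
  Uniform_isComplete.Build completion completion_complete.

Lemma riesz_approximable v : b v \in approximable.
Proof.
apply/approximableP => e e0; exists v => w.
by rewrite subrr normr0 mulr_ge0 ?psd_norm_ge0// ltW.
Qed.

Definition riesz v := Completion (riesz_approximable v).

Lemma rieszDZ a u v : riesz (a *: u + v) = a *: riesz u + riesz v.
Proof. by apply: completion_ext => w; exact: psdDZl. Qed.

(** Cauchy-Schwarz gives one inequality; evaluating the functional at [v] itself gives the other. *)
Lemma norm_riesz v : `|riesz v| = N v.
Proof.
apply/eqP; rewrite eq_le; apply/andP; split.
  by apply: dual_norm_le => [|w]; [exact: psd_norm_ge0|
    exact: psd_cauchy_schwarz].
have := psd_norm_ge0 b v; rewrite [0 <= _]le_eqVlt => /predU1P[v0|v0].
  by rewrite -v0 normr_ge0.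
rewrite -(ler_pM2r v0) (le_trans _ (dual_normP (riesz v) v))//.
by rewrite -expr2 sqr_psd_norm ler_norm.
Qed.

Lemma riesz_dense f : exists v_ : nat -> V, riesz (v_ n) @[n --> \oo] --> f.
Proof.
have /choice[v_ fv] (n : nat) : exists v, `|f - riesz v| <= n.+1%:R^-1.
  have n0 : (0 : R) < n.+1%:R^-1 by rewrite invr_gt0.
  have /approximableP/(_ _ n0)[v fv] := functional_approximable f.
  by exists v; apply: dual_norm_le => //; exact: ltW.
exists v_; apply/cvgrPdist_le => e e0.
have : (n.+1%:R^-1 : R) @[n --> \oo] --> (0 : R) by exact: cvg_harmonic.
move=> /cvgrPdist_le/(_ _ e0); apply: filterS => n.
rewrite sub0r normrN ger0_norm ?invr_ge0//.
exact: le_trans.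
Qed.

Definition inner f g : R := (`|f + g| ^+ 2 - `|f - g| ^+ 2) / 4.

Lemma inner_cvg (f_ g_ : nat -> completion) f g :
  f_ n @[n --> \oo] --> f -> g_ n @[n --> \oo] --> g ->
  inner (f_ n) (g_ n) @[n --> \oo] --> inner f g.
Proof.
move=> cf cg; apply: cvgMr_tmp; apply: cvgB; apply: cvgM; apply: cvg_norm;
  by [exact: cvgD|exact: cvgB].
Qed.

Lemma inner_riesz u v : inner (riesz u) (riesz v) = b u v.
Proof.
rewrite /inner.
have -> : riesz u + riesz v = riesz (u + v).
  by rewrite -[u in RHS]scale1r rieszDZ scale1r.
have -> : riesz u - riesz v = riesz (- v + u).
  by rewrite -scaleN1r rieszDZ scaleN1r addrC.
rewrite !norm_riesz !sqr_psd_norm -scaleN1r !psdDl !psdDr !psdZl !psdZr.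
by rewrite (psdC b v u); field.
Qed.

(** Symmetry and the diagonal value can be read off the polarization formula. For linearity, both
    sides are limits of one sequence, since on the image of [riesz] the pairing is [b]. *)
Lemma inner_is_inner_product : is_inner_product inner.
Proof.
split=> [f g|a f g h|f].
- by rewrite /inner (addrC f) (distrC f).
- have [f_ cf] := riesz_dense f; have [g_ cg] := riesz_dense g.
  have [h_ ch] := riesz_dense h.
  have cl := inner_cvg (cvgD (cvgZl_tmp (k := a) cf) cg) ch.
  have cr := cvgD (cvgMl_tmp (a := a) (inner_cvg cf ch)) (inner_cvg cg ch).
  apply: (cvg_unique (@norm_hausdorff R R) (cl _ _)).
  apply: cvg_trans (cr _ _); apply: near_eq_cvg; near=> n.
  rewrite -[LHS]/(a * inner _ _ + inner _ _) /= -rieszDZ.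
  by rewrite !inner_riesz psdDZl.
- rewrite /inner subrr normr0 expr0n/= subr0 -mulr2n -scaler_nat normrZ.
  by rewrite ger0_norm// exprMn; field.
Unshelve. all: by end_near. Qed.

End hilbert_completion.

(** * The L^2 form and Fubini for real-valued integrals *)

Section L2.
Context {d} {T : measurableType d} {R : realType}.
Variable mu : {measure set T -> \bar R}.
Local Notation L2 := (LfunType mu (lee1n 2 : (1 <= 2%:E)%E)).

Lemma Lfun2_mul_integrable (f g : L2) :
  mu.-integrable setT (EFin \o (f \* g)).
Proof. by apply/Lfun1_integrable/Lfun2_mul_Lfun1; exact: LfunP. Qed.

(** The form lives on functions, not on almost-everywhere classes, so it is only semidefinite; this
    suffices for [completion]. *)
Definition L2_form (f g : L2) : R := \int[mu]_x (f x * g x).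

Lemma L2_formC f g : L2_form f g = L2_form g f.
Proof. by apply: eq_Rintegral => x _; rewrite mulrC. Qed.

Lemma L2_formDZl a f g h :
  L2_form (a *: f + g) h = a * L2_form f h + L2_form g h.
Proof.
have ifh := Lfun2_mul_integrable f h.
rewrite -RintegralZl// -RintegralD//; last 2 first.
- exact: (integrableZl measurableT a ifh).
- exact: Lfun2_mul_integrable.
by apply: eq_Rintegral => x _; rewrite /= mulrDl mulrA.
Qed.

Lemma L2_form_ge0 f : 0 <= L2_form f f.
Proof. by apply: Rintegral_ge0 => x _; exact: sqr_ge0. Qed.

Definition L2_psd_form := PsdForm L2_formC L2_formDZl L2_form_ge0.

Lemma bounded_Lfun2 (D : set T) (f : T -> R) C :
  measurable D -> (mu D < +oo)%E -> measurable_fun D f ->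
  (forall x, D x -> `|f x| <= C) -> f \_ D \in Lfun mu 2%:E.
Proof.
move=> mD muD mf fC; rewrite inE; apply/andP; split; rewrite inE/=.
  exact/(measurable_restrictT _ mD).
rewrite /finite_norm unlock; apply: poweR_lty.
have -> : (\int[mu]_x `|(EFin \o f \_ D) x| `^ 2 =
    \int[mu]_(x in D) (`|f x| ^+ 2)%:E)%E.
  rewrite [RHS]integral_mkcond; apply: eq_integral => x _ /=.
  rewrite !patchE; case: ifPn => xD; last by rewrite normr0 powR0.
  by rewrite powR_mulrn.
apply: (@le_lt_trans _ _ (\int[mu]_(x in D) (C ^+ 2)%:E)%E).
  apply: ge0_le_integral => //.
  - by apply/measurable_EFinP; apply: measurable_funX; exact: measurableT_comp.
  (* The sign of [C] comes from the point [x] of [D], through the bound on [f x]. *)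
  - move=> x Dx; rewrite lee_fin lerXn2r ?nnegrE//; last exact: fC.
    exact: le_trans (fC _ Dx).
by rewrite integral_cst// lte_mul_pinfty// lee_fin sqr_ge0.
Qed.

End L2.

(** Almost every section of an integrable function is integrable, so taking the finite part of the
    inner integral changes it only on a null set. *)
Lemma Rfubini {d1 d2} {T1 : measurableType d1} {T2 : measurableType d2}
    {R : realType} (m1 : {sigma_finite_measure set T1 -> \bar R})
    (m2 : {sigma_finite_measure set T2 -> \bar R}) (f : T1 * T2 -> R) :
  (m1 \x m2)%E.-integrable setT (EFin \o f) ->
  \int[m1]_x \int[m2]_y f (x, y) = \int[(m1 \x m2)%E]_z f z.
Proof.
move=> fi; rewrite [RHS]/Rintegral -integral12_prod_meas1//.
congr fine; apply: ae_eq_integral => //.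
- apply/measurable_EFinP; apply: measurableT_comp => //.
  exact: (measurable_fubini_F fi).
- exact: (measurable_fubini_F fi).
- apply: filterS (ae_integrable1 fi) => x ix _.
  by rewrite fineK//; exact: integrable_fin_num.
Qed.

(** * Uniform bounds on the robustness *)

Section robustness_bound.
Context {R : realType} {n : nat}.
Implicit Types (phi : stl R n).

Lemma sup_norm_le (A : set R) C : A !=set0 ->
  (forall x, A x -> `|x| <= C) -> `|sup A| <= C.
Proof.
move=> [x Ax] AC; have C_ub : ubound A C.
  by move=> y /AC; apply: le_trans; exact: ler_norm.
rewrite ler_norml ge_sup ?andbT//; last by exists x.
rewrite (@le_trans _ _ x)//.
  by have := AC _ Ax; rewrite ler_norml => /andP[].
by apply: ub_le_sup => //; exists C.
Qed.

Lemma inf_norm_le (A : set R) C : A !=set0 ->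
  (forall x, A x -> `|x| <= C) -> `|inf A| <= C.
Proof.
move=> [x Ax] AC; rewrite /inf normrN; apply: sup_norm_le.
  by exists (- x); exists x.
by move=> _ [y Ay <-]; rewrite normrN AC.
Qed.

Lemma normr_min_le (x y C : R) : `|x| <= C -> `|y| <= C -> `|Num.min x y| <= C.
Proof. by case: (leP x y). Qed.

(** Closed balls of ['rV[R]_n] are compact, so their continuous images are bounded. *)
Lemma continuous_ball_bounded (f : 'rV[R]_n -> R) (B : R) : continuous f ->
  exists C, forall v, `|v| <= B -> `|f v| <= C.
Proof.
move=> cf; have cB : compact [set v : 'rV[R]_n | `|v| <= B].
  apply: bounded_closed_compact.
    by exists B; split=> [|M BM v/= vB]; [rewrite num_real|
      exact: le_trans (ltW BM)].
  have -> : [set v : 'rV[R]_n | `|v| <= B] =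
      Num.norm @^-1` [set r | r <= B] by [].
  apply: preimage_closed; last exact: closed_le.
  by move=> v _; exact: norm_continuous.
have /compact_bounded[M [_ MC]] : compact (f @` [set v : 'rV[R]_n | `|v| <= B]).
  by apply: continuous_compact cB; exact: continuous_subspaceT.
(* [MC] gives a bound only for numbers strictly above [M]. *)
exists (M + 1) => v vB; apply: (MC (M + 1)); first by rewrite ltrDl.
by exists v.
Qed.

(** Induction on [phi], with [C] chosen before the trajectory so that one constant serves the whole
    space. In the until case [0 <= a] keeps all inspected times at or after [t], hence
    nonnegative. *)
Lemma rho_bounded (ctt B : R) phi : exists C, forall xi : R -> 'rV[R]_n,
  (forall t, 0 <= t -> `|xi t| <= B) ->
  forall t, 0 <= t -> `|rho ctt phi xi t| <= C.
Proof.
elim: phi => /= [|f cf|p [C pC]|p [C pC] q [D qD]|a b a0 ab p [C pC] q [D qD]].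
- by exists `|ctt|.
- have [C fC] := continuous_ball_bounded B cf.
  by exists C => xi xiB t t0; apply/fC/xiB.
- by exists C => xi xiB t t0; rewrite normrN; exact: pC.
- exists (Num.max C D) => xi xiB t t0.
  by apply: normr_min_le; rewrite le_max (pC, qD) ?orbT.
- exists (Num.max C D) => xi xiB t t0.
  have a0' : 0 <= ratr a :> R by rewrite ler0q.
  apply: sup_norm_le => [|_ [s /= s_ab <-]].
    apply: image_nonempty; exists (ratr a + t) => /=.
    by rewrite in_itv/= lexx lerD2r ler_rat ltW.
  have ts : t <= s.
    move: s_ab; rewrite in_itv/= => /andP[+ _].
    by apply: le_trans; rewrite lerDr.
  apply: normr_min_le; first by rewrite le_max qD ?orbT// (le_trans t0).
  apply: inf_norm_le => [|_ [r /= r_ts <-]].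
    by apply: image_nonempty; exists t; rewrite /= in_itv/= lexx.
  rewrite le_max pC//.
  by move: r_ts; rewrite in_itv/= => /andP[+ _]; exact: le_trans.
Qed.

End robustness_bound.

(** * The feature map and the kernel identity *)

Theorem theorem1 (R : realType) (n : nat) (ctt : R) (hctt : 0 < ctt)
    (d : measure_display) (X : measurableType d)
    (traj : X -> R -> 'rV[R]_n)
    (htraj_cont : forall x, {within `[0, +oo[%classic, continuous traj x})
    (htraj_bdd : exists B : R, forall x t, 0 <= t -> `|traj x t| <= B)
    (hmeas : forall phi : stl R n,
       measurable_fun setT (fun p : X * R => rho ctt phi (traj p.1) p.2))
    (mu0 : probability X R)
    (I : set R) (hI_int : is_interval I)
    (hI_bdd : exists M : R, I `<=` `[- M, M]%classic)
    (hI_pos : I `<=` `[0, +oo[%classic) :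
  exists (H : completeNormedModType R) (ip : H -> H -> R) (Phi : stl R n -> H),
    is_inner_product ip /\
    forall phi psi : stl R n,
      kprime ctt traj mu0 I phi psi = ip (Phi phi) (Phi psi).
Proof.
pose mu := (mu0 \x @lebesgue_measure R)%E.
pose D : set (X * R) := setT `*` I.
(* Extension by zero outside [D] makes each robustness one function on the whole product space. *)
pose h phi : X * R -> R := (fun p => rho ctt phi (traj p.1) p.2) \_ D.
have mI : measurable I := is_interval_measurable hI_int.
have mD : measurable D by exact: measurableX.
have muD : (mu D < +oo)%E.
  have [M IM] := hI_bdd.
  (* [mu0] has total mass 1, so [mu D] is the length of [I]. *)
  have -> : mu D = lebesgue_measure I.
    rewrite /mu product_measure1E// -[RHS]mul1e; congr (_ * _)%E.
    exact: probability_setT.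
  apply: (@le_lt_trans _ _ (lebesgue_measure `[- M, M]%classic)).
    by apply: le_measure; rewrite ?inE.
  by rewrite lebesgue_measure_itv/=; case: ifP => _; rewrite -?EFinB ltry.
have hL2 phi : h phi \in Lfun mu 2%:E.
  have [B trajB] := htraj_bdd; have [C phiC] := rho_bounded ctt B phi.
  apply: (@bounded_Lfun2 _ _ _ mu _ _ C) => //.
    exact: measurable_funS (hmeas phi).
  move=> [x t] /= [_ It]; apply: phiC; first exact: trajB.
  by have := hI_pos _ It; rewrite /= in_itv/= andbT.
pose hL phi : LfunType mu (lee1n 2) := Lfun_Sub (lee1n 2) (hL2 phi).
exists (completion (L2_psd_form mu)), (@inner _ _ _).
exists (fun phi => riesz _ (hL phi)).
split=> [|phi psi]; first exact: inner_is_inner_product.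
(* Fubini turns the L^2 pairing into an iterated integral; the product of two extensions by zero is
   the extension by zero of the product. *)
rewrite inner_riesz /= /L2_form -Rfubini; last exact: Lfun2_mul_integrable.
apply: eq_Rintegral => x _; rewrite Rintegral_mkcond.
apply: eq_Rintegral => t _ /=; rewrite /h !patchE in_setX/= in_setT/=.
by case: ifP => _; rewrite ?mul0r.
Qed.
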